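(* Let $\{\alpha_n\}_{n\in\mathbb{N}}\subset(0,d)$ be such that $\alpha_n\to d^-$ as $n\to+\infty$. For every $u\in L^2(\Omega)$ and for every $\{u^n\}_{n\in\mathbb{N}}\subset L^2(\Omega)$ with $u^n\rightharpoonup u$ weakly in $L^2(\Omega)$ it holds $$\lim_{n\to+\infty}\widetilde{\mathcal{J}}^{\alpha_n}(u^n)=\widetilde{\mathcal{J}}^d(u).$$ In particular, as $\alpha\to d^-$, the functionals $\widetilde{\mathcal{J}}^\alpha$ (respectively $-\widetilde{\mathcal{J}}^\alpha$) $\Gamma$-converge to the functional $\widetilde{\mathcal{J}}^d$ (respectively $-\widetilde{\mathcal{J}}^d$) with respect to the weak convergence in $L^2(\Omega)$.
   Context: Let $d\in\mathbb{N}$ (with $d\ge 1$) and let $\Omega\subset\mathbb{R}^d$ be a bounded open set with Lipschitz continuous boundary. $L^2(\Omega)$ is the space of real-valued square-integrable functions. For $\alpha\in(0,d)$ and $u\in L^2(\Omega)$ set $$\mathcal{J}^\alpha(u):=-\int_\Omega\int_\Omega\frac{u(x)u(y)}{|x-y|^{d-\alpha}}\,dy\,dx,\qquad \mathcal{J}^d(u):=-\Big(\int_\Omega u(x)\,dx\Big)^2,\qquad \widetilde{\mathcal{J}}^\alpha(u):=\frac{\mathcal{J}^\alpha(u)-\mathcal{J}^d(u)}{d-\alpha},$$ $$\widetilde{\mathcal{J}}^d(u):=-\int_\Omega\int_\Omega u(x)u(y)\log\frac{1}{|x-y|}\,dy\,dx.$$ All these functionals take values in $\mathbb{R}$ on $L^2(\Omega)$.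 $\Gamma$-convergence of functionals $F^\alpha$ to $F$ as $\alpha\to d^-$ with respect to weak $L^2$ convergence is understood sequentially: for every sequence $\alpha_n\to d^-$ in $(0,d)$, (liminf) $F(u)\le\liminf_n F^{\alpha_n}(u^n)$ whenever $u^n\rightharpoonup u$ weakly in $L^2(\Omega)$, and (limsup) for every $u\in L^2(\Omega)$ there is a sequence $u^n\rightharpoonup u$ weakly in $L^2(\Omega)$ with $F^{\alpha_n}(u^n)\to F(u)$. *)

(* Defs.v *)
From HB Require Import structures.
From mathcomp Require Import all_boot all_order all_algebra.
From mathcomp Require Import all_classical all_reals all_analysis.

Set Implicit Arguments.
Unset Strict Implicit.
Unset Printing Implicit Defensive.

Import Order.TTheory GRing.Theory Num.Theory.
Import numFieldNormedType.Exports.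

Local Open Scope classical_set_scope.
Local Open Scope ring_scope.

(* As for n.-tuple T in the library: the sigma-algebra on 'rV[T]_n is generated
   by the coordinate projections; for T := R it is the Borel sigma-algebra of
   R^n. *)
Section measurable_rV.
Context {d : measure_display} {T : measurableType d} {n : nat}.

Definition rV_coord (i : 'I_n) (x : 'rV[T]_n) : T := x ord0 i.

Let rV_set0 : g_sigma_preimage rV_coord set0.
Proof. exact: sigma_algebra0. Qed.

Let rV_setC A : g_sigma_preimage rV_coord A -> g_sigma_preimage rV_coord (~` A).
Proof. exact: sigma_algebraC. Qed.

Let rV_bigcup (F : _^nat) : (forall i, g_sigma_preimage rV_coord (F i)) ->
  g_sigma_preimage rV_coord (\bigcup_i (F i)).
Proof. exact: sigma_algebra_bigcup. Qed.

HB.instance Definition _ := @isMeasurable.Build (measure_tuple_display d)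
  'rV[T]_n (g_sigma_preimage rV_coord) rV_set0 rV_setC rV_bigcup.

End measurable_rV.

Lemma measurable_rV_coord {d} {T : measurableType d} {n} (i : 'I_n) :
  measurable_fun setT (@rV_coord d T n i).
Proof.
move=> _ Y mY; rewrite setTI; apply: sub_sigma_algebra => /=.
rewrite -bigcup_seq/=; exists i => /=; first by rewrite mem_index_enum.
by exists Y => //; rewrite setTI.
Qed.

Lemma measurable_fun_rVP {d1 d2} {T1 : measurableType d1}
    {T2 : measurableType d2} {n} (f : T1 -> 'rV[T2]_n) :
  (forall i, measurable_fun setT (fun x => f x ord0 i)) ->
  measurable_fun setT f.
Proof.
move=> mf; suff: @measurable _ 'rV[T2]_n `<=` [set B | measurable (f @^-1` B)].
  by move=> H _ B mB; rewrite setTI; exact: H.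
apply: smallest_sub.
  split.
  - by rewrite /= preimage_set0.
  - by move=> B mB; rewrite /= setTD preimage_setC; exact: measurableC.
  - move=> F mF; rewrite /= preimage_bigcup.
    by apply: bigcup_measurable => k _; exact: mF.
rewrite -bigcup_seq => B [i _ [C mC <-]] /=.
by rewrite setTI -[X in measurable X]setTI; exact: mf.
Qed.

Section rV_cons.
Context {R : realType} {n : nat}.

Definition rV_cons (p : R * 'rV[R]_n) : 'rV[R]_n.+1 :=
  row_mx (const_mx p.1 : 'rV_1) p.2.

Definition rV_uncons (x : 'rV[R]_n.+1) : R * 'rV[R]_n :=
  (x ord0 ord0, rsubmx (x : 'rV_(1 + n))).

Lemma rV_cons0 p : rV_cons p ord0 ord0 = p.1.
Proof. by rewrite /= mxE; case: splitP => //= j _; rewrite mxE. Qed.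

Lemma rV_consS p i : rV_cons p ord0 (lift ord0 i) = p.2 ord0 i.
Proof.
rewrite (_ : lift ord0 i = rshift 1 i); last exact: val_inj.
exact: row_mxEr.
Qed.

Lemma rV_consK : cancel rV_cons rV_uncons.
Proof.
by case=> a v; rewrite /rV_uncons rV_cons0 /rV_cons row_mxKr.
Qed.

Lemma measurable_rV_cons : measurable_fun setT rV_cons.
Proof.
apply: measurable_fun_rVP => i; case: (unliftP ord0 i) => [j|] ->.
- under eq_fun do rewrite rV_consS.
  exact: (measurableT_comp (measurable_rV_coord j) measurable_snd).
- under eq_fun do rewrite rV_cons0.
  exact: measurable_fst.
Qed.

Lemma measurable_rV_uncons : measurable_fun setT rV_uncons.
Proof.
apply/measurable_fun_pair => /=; first exact: (measurable_rV_coord ord0).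
apply: measurable_fun_rVP => i.
rewrite [X in measurable_fun _ X](_ : _ = rV_coord (rshift 1 i : 'I_n.+1)).
  exact: measurable_rV_coord.
by apply/funext => x; rewrite mxE.
Qed.

Section step.
Variable mu : {sigma_finite_measure set 'rV[R]_n -> \bar R}.

Definition rV_cons_measure : set 'rV[R]_n.+1 -> \bar R :=
  pushforward (lebesgue_measure \x mu)%E rV_cons.

Let prod_mu : {measure set (measurableTypeR R * 'rV[R]_n)%type -> \bar R} :=
  (lebesgue_measure \x mu)%E.

HB.instance Definition _ := Measure.copy rV_cons_measure
  (measure_function_pushforward__canonical__measure_function_Measure
     prod_mu measurable_rV_cons).

Let rV_cons_measure_sigma_finite : sigma_finite setT rV_cons_measure.
Proof.
have /sigma_finiteP[F [UF ndF mF]] := sigma_finiteT (@lebesgue_measure R).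
have /sigma_finiteP[G [UG ndG mG]] := sigma_finiteT mu.
exists (fun k => rV_uncons @^-1` (F k `*` G k)).
  rewrite -preimage_bigcup [X in _ @^-1` X](_ : _ = setT) ?preimage_setT//.
  apply/seteqP; split=> // -[a v] _.
  have [i _ Fia] : (\bigcup_i F i) a by rewrite -UF.
  have [j _ Gjv] : (\bigcup_j G j) v by rewrite -UG.
  exists (maxn i j) => //; split => /=.
  - by move: a Fia; exact/subsetPset/ndF/leq_maxl.
  - by move: v Gjv; exact/subsetPset/ndG/leq_maxr.
move=> k; have [mFk Fkoo] := mF k; have [mGk Gkoo] := mG k; split.
  rewrite -[X in measurable X]setTI; apply: measurable_rV_uncons => //.
  exact: measurableX.
rewrite /rV_cons_measure /pushforward -comp_preimage.
rewrite (_ : rV_uncons \o rV_cons = id); last first.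
  by apply/funext => x; exact: rV_consK.
by rewrite preimage_id product_measure1E// lte_mul_pinfty// ge0_fin_numE.
Qed.

HB.instance Definition _ := Measure_isSigmaFinite.Build _ _ _
  rV_cons_measure rV_cons_measure_sigma_finite.

End step.
End rV_cons.

Fixpoint lebesgue_rV {R : realType} n :
    {sigma_finite_measure set 'rV[R]_n -> \bar R} :=
  if n is m.+1 then rV_cons_measure (lebesgue_rV m) else \d_(0 : 'rV[R]_0).

Lemma measurable_rV_box {d} {T : measurableType d} n (A : 'I_n -> set T) :
  (forall i, measurable (A i)) ->
  measurable [set x : 'rV[T]_n | forall i, A i (x ord0 i)].
Proof.
move=> mA; rewrite [X in measurable X](_ : _ =
    \bigcap_(i in [set: 'I_n]) (rV_coord i @^-1` A i)).
  apply: fin_bigcap_measurable => // i _.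
  by rewrite -[X in measurable X]setTI; exact: measurable_rV_coord.
by apply/seteqP; split=> x /= Ax i; [move=> _|]; exact: Ax.
Qed.

Lemma lebesgue_rV_box {R : realType} n (A : 'I_n -> set R) :
  (forall i, measurable (A i)) ->
  lebesgue_rV n [set x | forall i, A i (x ord0 i)] =
  (\prod_(i < n) lebesgue_measure (A i))%E.
Proof.
elim: n A => [|n IHn] A mA.
  rewrite big_ord0 /= diracE mem_set//; by case.
rewrite big_ord_recl -IHn; last by move=> i; exact: mA.
rewrite -product_measure1E; last 2 first.
- exact: mA.
- exact: (@measurable_rV_box _ _ _ (fun i => A (lift ord0 i))).
suff E : rV_cons @^-1` [set x | forall i, A i (x ord0 i)] =
    A ord0 `*` [set x : 'rV[R]_n | forall i, A (lift ord0 i) (x ord0 i)].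
  exact: (congr1 (lebesgue_measure \x lebesgue_rV n)%E E).
apply/seteqP; split=> -[a v] /=.
  move=> Aav; split=> [|i]; first by have := Aav ord0; rewrite rV_cons0.
  by have := Aav (lift ord0 i); rewrite rV_consS.
by move=> [Aa Av] i; case: (unliftP ord0 i) => [j|] ->;
  rewrite ?rV_consS ?rV_cons0.
Qed.

(* Not the library norm of 'rV[R]_n, which is the sup norm *)
Definition eucl_dist {R : realType} {n} (x y : 'rV[R]_n) : R :=
  Num.sqrt (\sum_(i < n) (x ord0 i - y ord0 i) ^+ 2).

Definition boundary {T : topologicalType} (A : set T) : set T :=
  closure A `\` interior A.

(* Near each boundary point, in suitable orthonormal coordinates (Q, i), Om is
   the strict epigraph of a Lipschitz function of the coordinates other than
   the i-th one. *)
Definition lipschitz_boundary {R : realType} {n} (Om : set 'rV[R]_n) : Prop :=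
  forall x0, boundary Om x0 ->
  exists (Q : 'M[R]_n) (i : 'I_n) (g : 'rV[R]_n.-1 -> R) (r : R),
    [/\ Q *m Q^T = 1%:M, lipschitz (g : 'rV[R]_n.-1 -> R^o), 0 < r &
        forall x, eucl_dist x x0 < r ->
          Om x <-> g (col' i (x *m Q)) < (x *m Q) ord0 i].

Section functionals.
Context {R : realType} {d : nat}.
Variable Om : set 'rV[R]_d.
Implicit Types (u v : 'rV[R]_d -> R) (a : R).

(* u \_ Om extends the restriction of u to Om by point, which is 0 in R *)
Definition L2 : set ('rV[R]_d -> R) :=
  [set u | u \_ Om \in Lfun (lebesgue_rV d) 2%:E].

Definition weakly_cvg (un : nat -> 'rV[R]_d -> R) u : Prop :=
  forall v, L2 v ->
    \int[lebesgue_rV d]_(x in Om) (un n x * v x) @[n --> \oo] -->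
    \int[lebesgue_rV d]_(x in Om) (u x * v x).

Definition J a u : R :=
  - \int[lebesgue_rV d]_(x in Om) \int[lebesgue_rV d]_(y in Om)
      (u x * u y / eucl_dist x y `^ (d%:R - a)).

Definition Jd u : R := - (\int[lebesgue_rV d]_(x in Om) u x) ^+ 2.

Definition Jtilde a u : R := (J a u - Jd u) / (d%:R - a).

Definition Jtilded u : R :=
  - \int[lebesgue_rV d]_(x in Om) \int[lebesgue_rV d]_(y in Om)
      (u x * u y * ln (1 / eucl_dist x y)).

Definition admissible (an : nat -> R) : Prop :=
  (forall n, 0 < an n < d%:R) /\ an @ \oo --> (d%:R : R)^'-.

Definition Gamma_cvg (F : R -> ('rV[R]_d -> R) -> R)
    (G : ('rV[R]_d -> R) -> R) : Prop :=
  forall an, admissible an ->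
    (forall u un, L2 u -> (forall n, L2 (un n)) -> weakly_cvg un u ->
       ((G u)%:E <= limn_einf (fun n => (F (an n) (un n))%:E))%E) /\
    (forall u, L2 u -> exists un, [/\ forall n, L2 (un n), weakly_cvg un u &
       F (an n) (un n) @[n --> \oo] --> G u]).

End functionals.

(* Main.v *)
Require Import Defs.
From mathcomp Require Import all_boot all_order all_algebra.
From mathcomp Require Import all_classical all_reals all_analysis.
From mathcomp Require Import measurable_realfun ring lra.

(** With e = d - a, the renormalised functional is minus the quadratic form of
    the kernel (|x-y|^-e - 1) / e on Om x Om. As e tends to 0 this kernel tends to
    ln (1 / |x-y|) at every pair of distinct points, and the singularity on the
    diagonal is weak, uniformly in e: with L = |ln |x-y||, the squares of all
    these kernels are at most 64 e^(L/2) as soon as e <= 1/8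
    (riesz_quotient_sqr_le, ln_sqr_le).

    The weight e^(L/2) behaves like |x-y|^(-1/2) near the diagonal, and Om is
    bounded, so its integral in y over Om is bounded uniformly in x
    (integral_log_weight_le). By dominated convergence the sections of the
    kernels converge in L2(Om), for every x (radial_kernel_cvg).

    It remains to see that quadratic forms with such kernels are continuous for
    weak convergence (kernel_form_cvg). A weakly convergent sequence is bounded in
    L2 (Lfun2_uniform_boundedness). Hence the associated integral operators send
    it to functions that converge at every point under an integrable domination,
    so strongly in L2, and the pairing of a weakly convergent sequence with a
    strongly convergent one passes to the limit.

    The convergence of the values along every weakly convergent sequence implies
    the Gamma-convergence of the functionals and of their opposites
    (continuous_cvg_Gamma). *)

Set Implicit Arguments.
Unset Strict Implicit.
Unset Printing Implicit Defensive.

Import Order.TTheory GRing.Theory Num.Theory.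
Import numFieldNormedType.Exports.

Local Open Scope classical_set_scope.
Local Open Scope ring_scope.

(** * Square-integrable functions *)

Section L2_theory.
Context (dsp : measure_display) (T : measurableType dsp) (R : realType).
Variable mu : {measure set T -> \bar R}.
Implicit Types f g h : T -> R.

Lemma measurable_Lfun p f : f \in Lfun mu p -> measurable_fun setT f.
Proof. by rewrite inE => /andP[/[!inE]]. Qed.

Lemma sqr_integrable_Lfun2 f : measurable_fun setT f ->
  mu.-integrable setT (EFin \o (fun x => f x ^+ 2)) -> f \in Lfun mu 2%:E.
Proof.
move=> mf /integrableP[_ fi].
rewrite inE; apply/andP; split; rewrite inE//= /finite_norm unlock.
apply: poweR_lty.
rewrite (le_lt_trans _ fi)// le_eqVlt; apply/orP; left; apply/eqP.
apply: eq_integral => x _ /=.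
by rewrite powR_mulrn// -normrX.
Qed.

Lemma Lfun2M_integrable f g : f \in Lfun mu 2%:E -> g \in Lfun mu 2%:E ->
  mu.-integrable setT (EFin \o (fun x => f x * g x)).
Proof. by move=> f2 g2; apply/Lfun1_integrable; exact: Lfun2_mul_Lfun1. Qed.

Lemma Lfun2D f g : f \in Lfun mu 2%:E -> g \in Lfun mu 2%:E ->
  (fun x => f x + g x) \in Lfun mu 2%:E.
Proof.
move=> f2 g2.
have [_ /(_ 1 _ _ f2 g2)] := @Lfun_submod_closed _ T R mu _ (lee1n 2).
by rewrite scale1r.
Qed.

Lemma Lfun2Z k f : f \in Lfun mu 2%:E -> (fun x => k * f x) \in Lfun mu 2%:E.
Proof.
move=> f2; have := @Lfun_scale _ T R mu f k 2 (ler1n _ _) f2.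
rewrite (_ : _ \o* _ = fun x => k * f x)//.
by apply/funext => x /=; rewrite mulrC.
Qed.

Lemma Lfun2B f g : f \in Lfun mu 2%:E -> g \in Lfun mu 2%:E ->
  (fun x => f x - g x) \in Lfun mu 2%:E.
Proof.
move=> f2 g2; under eq_fun do rewrite -mulN1r.
exact: Lfun2D f2 (Lfun2Z (-1) g2).
Qed.

Lemma cauchy_schwarz f g : f \in Lfun mu 2%:E -> g \in Lfun mu 2%:E ->
  (\int[mu]_x (f x * g x)) ^+ 2 <=
  (\int[mu]_x (f x ^+ 2)) * (\int[mu]_x (g x ^+ 2)).
Proof.
move=> f2 g2.
have quad a b : 0 <= a ^+ 2 * (\int[mu]_x (f x ^+ 2)) +
    a * b *+ 2 * (\int[mu]_x (f x * g x)) + b ^+ 2 * (\int[mu]_x (g x ^+ 2)).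
  have fg := Lfun2M_integrable f2 g2.
  have ff := Lfun2_integrable_sqr f2.
  have gg := Lfun2_integrable_sqr g2.
  have Zi k h : mu.-integrable setT (EFin \o h) ->
      mu.-integrable setT (EFin \o (fun x => k * h x)).
    by move=> hi; exact: (integrableZl measurableT k hi).
  have Di h1 h2 : mu.-integrable setT (EFin \o h1) ->
      mu.-integrable setT (EFin \o h2) ->
      mu.-integrable setT (EFin \o (fun x => h1 x + h2 x)).
    by move=> i1 i2; exact: (integrableD measurableT i1 i2).
  rewrite -!RintegralZl// -(RintegralD measurableT (Zi _ _ ff) (Zi _ _ fg)).
  rewrite -(RintegralD measurableT (Di _ _ (Zi _ _ ff) (Zi _ _ fg)) (Zi _ _ gg)).
  apply: Rintegral_ge0 => x _.
  have -> : a ^+ 2 * f x ^+ 2 + a * b *+ 2 * (f x * g x) +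
      b ^+ 2 * g x ^+ 2 =
    (a * f x + b * g x) ^+ 2 by ring.
  exact: sqr_ge0.
set A := Rintegral _ _ _ in quad *; set B := Rintegral _ _ _ in quad *;
  set C := Rintegral _ _ _ in quad *.
have A0 : 0 <= A by apply: Rintegral_ge0 => x _; exact: sqr_ge0.
have C0 : 0 <= C by apply: Rintegral_ge0 => x _; exact: sqr_ge0.
have [Cp|] := ltrP 0 C.
  (* the form is minimal in b at b = - a * B / C; a = C clears the denominator *)
  have := quad C (- B).
  have -> : C ^+ 2 * A + C * - B *+ 2 * B + (- B) ^+ 2 * C =
      C * (A * C - B ^+ 2).
    by ring.
  by rewrite pmulr_rge0// subr_ge0.
move=> Cn; have {Cn}C00 : C = 0 by apply/eqP; rewrite eq_le Cn C0.
(* with C = 0 the form is affine in b, so any large b forces B = 0 *)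
have := quad (- B) (A + 1).
rewrite C00 !mulr0 addr0.
have -> : (- B) ^+ 2 * A + - B * (A + 1) *+ 2 * B = - (B ^+ 2 * (A + 2)).
  by ring.
by rewrite oppr_ge0 pmulr_lle0// ltr_wpDl.
Qed.

Lemma normr_Rintegral_mul_le f g (a b : R) :
  f \in Lfun mu 2%:E -> g \in Lfun mu 2%:E -> 0 <= a -> 0 <= b ->
  \int[mu]_x (f x ^+ 2) <= a ^+ 2 -> \int[mu]_x (g x ^+ 2) <= b ^+ 2 ->
  `|\int[mu]_x (f x * g x)| <= a * b.
Proof.
move=> f2 g2 a0 b0 fa gb; rewrite -ler_sqr ?nnegrE ?mulr_ge0//.
rewrite real_normK ?num_real// (le_trans (cauchy_schwarz f2 g2))// exprMn.
by apply: ler_pM => //; apply: Rintegral_ge0 => x _; exact: sqr_ge0.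
Qed.

Lemma Rintegral_dominated_cvg (f_ : nat -> T -> R) f g :
  (forall n, measurable_fun setT (f_ n)) -> measurable_fun setT f ->
  {ae mu, forall x, f_ ^~ x @ \oo --> f x} ->
  mu.-integrable setT (EFin \o g) ->
  {ae mu, forall x n, `|f_ n x| <= g x} ->
  mu.-integrable setT (EFin \o f) /\
  \int[mu]_x f_ n x @[n --> \oo] --> \int[mu]_x f x.
Proof.
move=> mf_ mf ff gi fg.
have [||||| i _ c] := @dominated_convergence _ T R mu setT measurableT
  (fun n x => (f_ n x)%:E) (EFin \o f) (EFin \o g).
- by move=> n; apply/measurable_EFinP.
- exact/measurable_EFinP.
- apply: filterS ff => x fx _.
  by apply: cvg_EFin; [exact: nearW|exact: fx].
- exact: gi.
- by apply: filterS fg => x fx n _; rewrite lee_fin.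
split=> //; apply: fine_cvg.
by rewrite fineK//; exact: integrable_fin_num.
Qed.

(** Cauchy-Schwarz for weights. The bound involves only one increasing sum, so
    that a single function dominates the squares of all partial sums of a
    series of functions. *)
Lemma sqr_sum_weighted_le (c w : nat -> R) (C : R) :
  (forall k, 0 <= c k) -> (forall n, \sum_(0 <= k < n) c k <= C) ->
  forall n, (\sum_(0 <= k < n) c k * w k) ^+ 2 <=
    C * \sum_(0 <= k < n) c k * w k ^+ 2.
Proof.
move=> c0 cC n.
have H0 : 0 <= \sum_(0 <= k < n) c k * w k ^+ 2.
  by apply: sumr_ge0 => k _; rewrite mulr_ge0// sqr_ge0.
apply: le_trans (ler_wpM2r H0 (cC n)).
clear H0; elim: n => [|n IHn]; first by rewrite !big_geq// mulr0 expr0n.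
rewrite !big_nat_recr//=.
set S := \sum_(0 <= i < n) c i * w i in IHn *.
set A := \sum_(0 <= i < n) c i in IHn *.
set H := \sum_(0 <= i < n) c i * w i ^+ 2 in IHn *.
have A0 : 0 <= A by apply: sumr_ge0.
have H0 : 0 <= H by apply: sumr_ge0 => k _; rewrite mulr_ge0// sqr_ge0.
have a0 := c0 n; set a := c n in a0 *; set b := w n.
(* the cross term of the square is bounded by means of S ^+ 2 / A <= H *)
suff amgm : S * b *+ 2 <= A * b ^+ 2 + H.
  have := ler_wpM2l a0 amgm; nra.
have [A00|Ap] := eqVneq A 0.
  have S0 : S = 0.
    by apply/eqP; rewrite -sqrf_eq0 eq_le sqr_ge0 (le_trans IHn)// A00 mul0r.
  by rewrite S0 A00 !mul0r mul0rn add0r.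
have {}Ap : 0 < A by rewrite lt_def Ap.
rewrite -(ler_pM2l Ap) mulrDr.
have := sqr_ge0 (A * b - S); nra.
Qed.

(** The part of the completeness of L2 that the uniform boundedness principle
    uses: an absolutely convergent series of L2 functions has a sum, reached by
    weak convergence. The function h = sum_k c_k (w_k)^2 has integral at most C,
    hence is finite almost everywhere; where it is finite the series converges
    absolutely, and C * h dominates the squares of the partial sums, which
    gives both z in L2 and dominated convergence against any v. *)
Lemma Lfun2_series (c : nat -> R) (w : nat -> T -> R) (C : R) :
  (forall k, 0 <= c k) -> (forall n, \sum_(0 <= k < n) c k <= C) ->
  (forall k, w k \in Lfun mu 2%:E) -> (forall k, \int[mu]_x (w k x ^+ 2) <= 1) ->
  exists2 z, z \in Lfun mu 2%:E & forall v, v \in Lfun mu 2%:E ->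
    \int[mu]_x (v x * \sum_(0 <= k < n) c k * w k x) @[n --> \oo] -->
    \int[mu]_x (v x * z x).
Proof.
move=> c0 cC w2 w1.
have mw k : measurable_fun setT (w k) by exact: measurable_Lfun (w2 k).
have C0 : 0 <= C by apply: le_trans (cC 0); rewrite big_geq.
pose e k t := (c k * w k t ^+ 2)%:E.
have e0 k t : (0 <= e k t)%E by rewrite lee_fin mulr_ge0// sqr_ge0.
have me k : measurable_fun setT (e k).
  by apply/measurable_EFinP; apply: measurable_funM => //; exact: measurable_funX.
pose h t := (\sum_(0 <= k <oo) e k t)%E.
have mh : measurable_fun setT h.
  by apply: ge0_emeasurable_sum => // k x _ _; exact: e0.
have h0 t : (0 <= h t)%E by apply: nneseries_ge0 => k _ _; exact: e0.
have hi : mu.-integrable setT h.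
  apply/integrableP; split => //.
  under eq_integral => t _ do rewrite gee0_abs//.
  rewrite integral_nneseries//.
  apply: (@le_lt_trans _ _ C%:E); last exact: ltry.
  apply: lime_le; first by apply: is_cvg_nneseries => k _ _; exact: integral_ge0.
  apply: nearW => n; apply: (@le_trans _ _ (\sum_(0 <= k < n) c k)%:E); last first.
    by rewrite lee_fin.
  rewrite -sumEFin; apply: lee_sum => k _.
  have wi := Lfun2_integrable_sqr (w2 k).
  under eq_integral do rewrite /e EFinM.
  rewrite (integralZl measurableT wi) -[leRHS]mule1 lee_wpmul2l ?lee_fin//.
  rewrite -[X in (X <= _)%E]fineK ?lee_fin; first exact: w1.
  exact: (integrable_fin_num _ wi).
pose A := [set t | h t \is a fin_num].
have mA : measurable A by rewrite -[A]setTI; exact: emeasurable_fin_num.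
pose S n t := \sum_(0 <= k < n) c k * w k t.
have mS n : measurable_fun setT (S n).
  by apply: measurable_sum => k; exact: measurable_funM.
have Hh n t : A t -> \sum_(0 <= k < n) c k * w k t ^+ 2 <= fine (h t).
  move=> At; rewrite -lee_fin fineK// -sumEFin.
  by apply: nneseries_lim_ge => k _ _; exact: e0.
have Sh n t : A t -> S n t ^+ 2 <= C * fine (h t).
  move=> At; apply: le_trans (sqr_sum_weighted_le (w ^~ t) c0 cC n) _.
  by apply: ler_wpM2l => //; exact: Hh.
have cvS t : A t -> cvgn (S ^~ t).
  move=> At; apply: (@normed_cvg _ R^o (fun k => c k * w k t)).
  apply: nondecreasing_is_cvgn.
    apply/nondecreasing_seqP => n.
    by rewrite /normed_series_of seriesSr (@lerDl R) normr_ge0.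
  exists (C + fine (h t)) => _ [n _ <-].
  apply: le_trans (lerD (cC n) (Hh n t At)).
  rewrite -big_split/=; apply: ler_sum => k _.
  rewrite normrM ger0_norm// -[X in X + _]mulr1 -mulrDr ler_wpM2l//.
  rewrite -[w k t ^+ 2]real_normK ?num_real//.
  have := sqr_ge0 (`|w k t| - 2^-1); nra.
(* cutting off by A makes the sequence converge everywhere, so that its limit
   is measurable *)
pose z t := limn (fun n => S n t * \1_A t).
have zE t : A t -> S n t @[n --> \oo] --> z t.
  move=> At; rewrite /z indicE mem_set//=.
  under [in X in _ --> X]eq_fun do rewrite mulr1.
  exact: cvS.
have z0 t : ~ A t -> z t = 0.
  move=> At; rewrite /z indicE memNset//=; under eq_fun do rewrite mulr0.
  exact: lim_cst.
have mz : measurable_fun setT z.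
  apply: (@measurable_fun_cvg _ _ _ _ (fun n t => S n t * \1_A t)) => [n|t _].
    exact: measurable_funM.
  have [At|At] := pselect (A t); rewrite indicE.
    by rewrite mem_set//=; under eq_fun do rewrite mulr1; exact: zE.
  by rewrite memNset// z0//; under eq_fun do rewrite mulr0; exact: cvg_cst.
have hae : {ae mu, forall t, A t}.
  by apply: filterS (integrable_ae measurableT hi) => t; exact.
have fhi : mu.-integrable setT (EFin \o (fun t => C * fine (h t))).
  have fh : mu.-integrable setT (EFin \o (fine \o h)).
    apply: (le_integrable measurableT _ _ hi) => [|t _].
      by apply/measurable_EFinP; exact: measurableT_comp.
    rewrite /= ger0_norm ?fine_ge0// gee0_abs//.
    by have := h0 t; case: (h t) => [r _|_|//] //=; rewrite leey.
  exact: (integrableZl measurableT C fh).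
have zh t : z t ^+ 2 <= C * fine (h t).
  have [At|At] := pselect (A t); last first.
    by rewrite z0// expr0n/= mulr_ge0// fine_ge0.
  have zz : S n t ^+ 2 @[n --> \oo] --> z t ^+ 2.
    by rewrite expr2; under eq_fun do rewrite expr2; apply: cvgM; exact: zE.
  rewrite -(cvg_lim _ zz)//; apply: limr_le; last by apply: nearW => n; exact: Sh.
  by apply/cvg_ex; eexists; exact: zz.
have z2 : z \in Lfun mu 2%:E.
  apply: sqr_integrable_Lfun2 => //; apply: (le_integrable measurableT _ _ fhi) => [|t _].
    by apply/measurable_EFinP; exact: measurable_funX.
  by rewrite /= lee_fin ger0_norm ?sqr_ge0// (le_trans (zh t))// ler_norm.
exists z => // v v2; have mv := measurable_Lfun v2.
have vi := Lfun2_integrable_sqr v2.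
have [|||||_ //] := @Rintegral_dominated_cvg (fun n t => v t * S n t)
   (fun t => v t * z t) (fun t => v t ^+ 2 + C * fine (h t)).
- by move=> n; exact: measurable_funM.
- exact: measurable_funM.
- by apply: filterS hae => t At; apply: cvgM; [exact: cvg_cst|exact: zE].
- exact: (integrableD measurableT vi fhi).
- apply: filterS hae => t At n; rewrite normrM.
  apply: le_trans (lerD (lexx _) (Sh n t At)).
  have := sqr_ge0 (`|v t| - `|S n t|).
  rewrite -[v t ^+ 2]real_normK ?num_real// -[S n t ^+ 2]real_normK ?num_real//.
  have := mulr_ge0 (normr_ge0 (v t)) (normr_ge0 (S n t)); nra.
Qed.

End L2_theory.

(** * Uniform boundedness in L2 *)

Section uniform_boundedness.
Context (dsp : measure_display) (T : measurableType dsp) (R : realType).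
Variable mu : {measure set T -> \bar R}.

(** A gliding hump. If the norms N k of a subsequence U k exceed 4^k, add up the
    normalised U k with weights 3^-k, choosing the sign of each term so that it
    does not cancel the pairing of U k with the sum of the previous ones. Then
    this pairing is at least 3^-k N k at step k, and the later terms change it
    by at most half of that, since the sum of 3^-j over j > k is 3^-k / 2. So
    the pairing of U k with the sum z is at least (4/3)^k / 2, which is
    unbounded. *)
Lemma Lfun2_uniform_boundedness (u : nat -> T -> R) :
  (forall n, u n \in Lfun mu 2%:E) ->
  (forall v, v \in Lfun mu 2%:E ->
     exists C, forall n, `|\int[mu]_x (u n x * v x)| <= C) ->
  exists M, forall n, \int[mu]_x (u n x ^+ 2) <= M.
Proof.
move=> u2 ub; apply: contrapT => nb.
have {nb} big (k : nat) : exists n, (4 ^+ k) ^+ 2 < \int[mu]_x (u n x ^+ 2).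
  apply: contrapT => /forallNP H; apply: nb; exists ((4 ^+ k) ^+ 2) => n.
  by rewrite leNgt; apply/negP/H.
have [f fP] := choice big.
pose U k := u (f k).
pose N k := Num.sqrt (\int[mu]_x (U k x ^+ 2)).
have U2 k : U k \in Lfun mu 2%:E by exact: u2.
have N2 k : \int[mu]_x (U k x ^+ 2) = N k ^+ 2.
  by rewrite sqr_sqrtr// Rintegral_ge0// => x _; exact: sqr_ge0.
have N4 k : 4 ^+ k <= N k.
  rewrite -ler_sqr ?nnegrE ?exprn_ge0 ?sqrtr_ge0// -N2; exact/ltW/fP.
have N0 k : 0 < N k by apply: lt_le_trans (N4 k); rewrite exprn_gt0.
pose c k : R := 3^-1 ^+ k.
have c0 k : 0 <= c k by rewrite exprn_ge0.
pose sg k (y : T -> R) : R := if 0 <= \int[mu]_x (U k x * y x) then 1 else -1.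
have sg1 k y : sg k y ^+ 2 = 1 by rewrite /sg; case: ifP; rewrite ?sqrrN expr1n.
pose step k (y : T -> R) t := sg k y / N k * U k t.
pose X := fix X k : T -> R := if k is j.+1 then
  (fun t => X j t + c j * step j (X j) t) else cst 0.
pose w k := step k (X k).
have w2 k : w k \in Lfun mu 2%:E by exact: (Lfun2Z (sg k (X k) / N k) (U2 k)).
have w1 k : \int[mu]_x (w k x ^+ 2) <= 1.
  rewrite /w /step; under eq_Rintegral do rewrite exprMn.
  rewrite RintegralZl//; last first.
    exact: Lfun2_integrable_sqr (U2 k).
  by rewrite N2 exprMn sg1 mul1r -exprMn mulVf ?expr1n// gt_eqF.
have XE n t : X n t = \sum_(0 <= k < n) c k * w k t.
  by elim: n => [|n IHn]; [rewrite big_geq|rewrite big_nat_recr//= -IHn].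
have X2 n : X n \in Lfun mu 2%:E.
  elim: n => [|n IHn] /=.
    have := Lfun2Z 0 (U2 0%N).
    by rewrite (_ : (fun x => 0 * U 0%N x) = cst 0)//; apply/funext => x; rewrite mul0r.
  by apply: (Lfun2D IHn); exact: (Lfun2Z (c n) (w2 n)).
have cC n : \sum_(0 <= k < n) c k <= 2.
  suff -> : \sum_(0 <= k < n) c k = 3 / 2 * (1 - c n) by have := c0 n; lra.
  elim: n => [|n IHn]; first by rewrite big_geq// /c expr0 subrr mulr0.
  by rewrite big_nat_recr//= IHn /c exprS; field.
have [z z2 zP] := @Lfun2_series _ _ _ mu c w 2 c0 cC w2 w1.
pose B k y := \int[mu]_x (U k x * y x).
have BX k n : B k (X n.+1) = B k (X n) + c n * B k (w n).
  rewrite /B -RintegralZl//; last exact: Lfun2M_integrable.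
  rewrite -RintegralD//; last 2 first.
  - exact: Lfun2M_integrable.
  - exact: (integrableZl measurableT (c n) (Lfun2M_integrable (U2 k) (w2 n))).
  by apply: eq_Rintegral => x _ /=; rewrite -/(w n x) mulrDr mulrCA.
have Bdiag k : B k (w k) = sg k (X k) * N k.
  rewrite /B /w /step; under eq_Rintegral do rewrite mulrCA -expr2.
  rewrite RintegralZl//; last exact: Lfun2_integrable_sqr (U2 k).
  by rewrite N2 expr2 mulrA divfK// gt_eqF.
have Bw k n : `|B k (w n)| <= N k.
  rewrite -[leRHS]mulr1; apply: normr_Rintegral_mul_le => //; first exact: ltW.
  - by rewrite N2.
  - by rewrite expr1n.
have hump k : c k * N k <= `|B k (X k.+1)|.
  rewrite BX Bdiag /sg -/(B k (X k)); have := mulr_ge0 (c0 k) (ltW (N0 k)).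
  case: ifPn => [B0 cN|]; first by rewrite mul1r ger0_norm ?addr_ge0// lerDr.
  rewrite -ltNge => B0 cN; rewrite mulN1r mulrN ltr0_norm; last by lra.
  by lra.
(* after n further steps the loss is at most c k * N k / 2 * (1 - 3^-n) *)
have tail k n : c k * N k / 2 * (1 + 3^-1 ^+ n) <= `|B k (X (k.+1 + n)%N)|.
  elim: n => [|n IHn]; first by rewrite addn0 expr0; have := hump k; lra.
  rewrite addnS BX; apply: le_trans (lerB_normD _ _).
  have -> : c k * N k / 2 * (1 + 3^-1 ^+ n.+1) =
    c k * N k / 2 * (1 + 3^-1 ^+ n) - c (k.+1 + n)%N * N k.
    by rewrite /c addSnnS exprD exprS; field.
  apply: lerB => //; rewrite normrM ger0_norm//; exact: ler_wpM2l.
have low k : c k * N k / 2 <= `|B k z|.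
  have cv : `|B k (X n)| @[n --> \oo] --> `|B k z|.
    apply: cvg_norm; rewrite /B; under eq_fun do under eq_Rintegral do rewrite XE.
    exact: zP.
  rewrite -(cvg_lim _ cv)//; apply: limr_ge.
    by apply/cvg_ex; eexists; exact: cv.
  exists k.+1 => // n /= kn; rewrite -(subnKC kn).
  apply: le_trans (tail k (n - k.+1)%N).
  by rewrite ler_peMr ?divr_ge0 ?mulr_ge0 ?(ltW (N0 k))// lerDl exprn_ge0.
have [C CP] := ub z z2.
(* Bernoulli: (4 / 3) ^+ k >= 1 + k / 3 *)
have grow k : k%:R / 6 <= C.
  apply: le_trans (CP (f k)); apply: le_trans (low k).
  apply: (@le_trans _ _ (c k * 4 ^+ k / 2)); last first.
    by rewrite ler_pM2r// ler_wpM2l.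
  rewrite /c -exprMn ler_pdivlMr//.
  have -> : k%:R / 6 * 2 = k%:R / 3 :> R by field.
  elim: k => [|k IHk]; first by rewrite mul0r.
  rewrite exprS -natr1.
  have : 1 <= (3^-1 * 4) ^+ k :> R by apply: exprn_ege1; lra.
  by move: IHk; lra.
have C0 : 0 <= C by have := grow 0%N; rewrite mul0r.
have := grow (Num.bound (C * 6)); rewrite ler_pdivrMr//; apply/negP; rewrite -ltNge.
by rewrite archi_boundP// mulr_ge0.
Qed.

End uniform_boundedness.

(** * Quadratic forms of square-integrable kernels *)

Section quadratic_forms.
Context (dsp : measure_display) (T : measurableType dsp) (R : realType).
Variable mu : {sigma_finite_measure set T -> \bar R}.
Implicit Types (K : T * T -> R) (u h : T -> R).

Definition kernel_op K u x : R := \int[mu]_y (u y * K (x, y)).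

Definition kernel_form K u : R := \int[mu]_x \int[mu]_y (u x * u y * K (x, y)).

(** Square integrability is required of every section K (x, .), with a bound
    h x, rather than for almost every x: an integrable h then dominates the
    squares of all the functions kernel_op K u with u in a ball of L2. *)
Definition L2_kernel h K := measurable_fun setT K /\
  forall x, (fun y => K (x, y)) \in Lfun mu 2%:E /\
    \int[mu]_y (K (x, y) ^+ 2) <= h x.

Lemma measurable_kernel_op K u : measurable_fun setT K -> measurable_fun setT u ->
  measurable_fun setT (kernel_op K u).
Proof.
move=> mK mu_.
pose F (p : T * T) := (u p.2 * K p)%:E.
have mF : measurable_fun setT F.
  apply/measurable_EFinP; apply: measurable_funM => //.
  exact: (measurableT_comp mu_ measurable_snd).
apply: (@measurableT_comp _ _ _ _ _ _ fine _
  (fun x => \int[mu]_y (u y * K (x, y))%:E)%E) => //.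
(* Tonelli's theorem applies to the positive and to the negative part *)
have -> : (fun x => \int[mu]_y (u y * K (x, y))%:E)%E =
    (fubini_F mu F^\+ \- fubini_F mu F^\-)%E.
  apply/funext => x; rewrite [LHS]integralE /fubini_F /=.
  by congr (_ - _)%E; apply: eq_integral => y _; rewrite ?funeposE ?funenegE.
apply: emeasurable_funB; apply: measurable_fun_fubini_tonelli_F => //.
- exact: measurable_funepos.
- exact: measurable_funeneg.
Qed.

Lemma kernel_op_sqr_le h K u M x : L2_kernel h K -> u \in Lfun mu 2%:E ->
  \int[mu]_y (u y ^+ 2) <= M -> kernel_op K u x ^+ 2 <= M * h x.
Proof.
move=> [_ /(_ x)[Kx Kh]] u2 uM; apply: le_trans (cauchy_schwarz u2 Kx) _.
by apply: ler_pM => //; apply: Rintegral_ge0 => y _; exact: sqr_ge0.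
Qed.

Lemma kernel_op_Lfun2 h K u : mu.-integrable setT (EFin \o h) ->
  L2_kernel h K -> u \in Lfun mu 2%:E -> kernel_op K u \in Lfun mu 2%:E.
Proof.
move=> hi Kh u2; have mT := measurable_kernel_op Kh.1 (measurable_Lfun u2).
pose M := \int[mu]_y (u y ^+ 2).
apply: sqr_integrable_Lfun2 => //.
apply: (le_integrable measurableT _ _ (integrableZl measurableT M hi)).
  by apply/measurable_EFinP; exact: measurable_funX.
move=> x _; rewrite /= lee_fin ger0_norm ?sqr_ge0// (le_trans _ (ler_norm _))//.
exact: (kernel_op_sqr_le x Kh u2 (lexx _)).
Qed.

Lemma kernel_formE h K u : L2_kernel h K -> u \in Lfun mu 2%:E ->
  kernel_form K u = \int[mu]_x (u x * kernel_op K u x).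
Proof.
move=> [_ Kh] u2; apply: eq_Rintegral => x _.
rewrite -RintegralZl//; last by apply: Lfun2M_integrable => //; case: (Kh x).
by apply: eq_Rintegral => y _; rewrite mulrA.
Qed.

Lemma kernel_formB h K1 K2 a u : mu.-integrable setT (EFin \o h) ->
  L2_kernel h K1 -> L2_kernel h K2 ->
  L2_kernel h (fun p => a * (K1 p - K2 p)) -> u \in Lfun mu 2%:E ->
  kernel_form (fun p => a * (K1 p - K2 p)) u =
  a * (kernel_form K1 u - kernel_form K2 u).
Proof.
move=> hi K1h K2h Kh u2.
rewrite (kernel_formE Kh u2) (kernel_formE K1h u2) (kernel_formE K2h u2).
have i1 := Lfun2M_integrable u2 (kernel_op_Lfun2 hi K1h u2).
have i2 := Lfun2M_integrable u2 (kernel_op_Lfun2 hi K2h u2).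
rewrite -RintegralB// -RintegralZl//; last exact: (integrableB measurableT i1 i2).
apply: eq_Rintegral => x _.
rewrite -mulrBr mulrCA; congr (_ * _).
have [_ /(_ x)[k1 _]] := K1h; have [_ /(_ x)[k2 _]] := K2h.
have j1 := Lfun2M_integrable u2 k1; have j2 := Lfun2M_integrable u2 k2.
rewrite /kernel_op -RintegralB// -RintegralZl//; last first.
  exact: (integrableB measurableT j1 j2).
by apply: eq_Rintegral => y _; rewrite -mulrBr mulrCA.
Qed.

(** Operators with an L2 kernel are compact: they turn weak convergence of
    bounded sequences into strong convergence. Indeed kernel_op (K_ n) (u_ n) x
    tends to kernel_op K u x for every x, by weak convergence tested on the
    section K (x, .) and by Cauchy-Schwarz for the difference of the kernels;
    the squares are dominated by M * h, so the convergence holds in L2. It then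
    only remains to pair a weakly and a strongly convergent sequence. *)
Lemma kernel_form_cvg h (K_ : nat -> T * T -> R) K (u_ : nat -> T -> R) u :
  mu.-integrable setT (EFin \o h) ->
  (forall n, L2_kernel h (K_ n)) -> L2_kernel h K ->
  (forall x, \int[mu]_y ((K_ n (x, y) - K (x, y)) ^+ 2) @[n --> \oo] --> (0 : R)) ->
  (forall n, u_ n \in Lfun mu 2%:E) -> u \in Lfun mu 2%:E ->
  (forall v, v \in Lfun mu 2%:E ->
    \int[mu]_x (u_ n x * v x) @[n --> \oo] --> \int[mu]_x (u x * v x)) ->
  kernel_form (K_ n) (u_ n) @[n --> \oo] --> kernel_form K u.
Proof.
move=> hi K_h Kh KK u_2 u2 uu.
have [M uM] : exists M, forall n, \int[mu]_x (u_ n x ^+ 2) <= M.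
  apply: Lfun2_uniform_boundedness => // v v2.
  have [C [_ CP]] := cvg_seq_bounded (cvgP _ (uu v v2)).
  by exists (C + 1) => n; apply: CP => //; rewrite ltrDl.
have M0 : 0 <= M.
  apply: le_trans (uM 0%N).
  by apply: Rintegral_ge0 => x _; exact: sqr_ge0.
pose S n := kernel_op (K_ n) (u_ n); pose S0 := kernel_op K u.
have S2 n : S n \in Lfun mu 2%:E by exact: kernel_op_Lfun2 hi (K_h n) (u_2 n).
have S02 : S0 \in Lfun mu 2%:E by exact: kernel_op_Lfun2 hi Kh u2.
have Kx2 x : (fun y => K (x, y)) \in Lfun mu 2%:E by have [_ /(_ x)[]] := Kh.
have K_x2 n x : (fun y => K_ n (x, y)) \in Lfun mu 2%:E.
  by have [_ /(_ x)[]] := K_h n.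
have SS0 x : S n x @[n --> \oo] --> S0 x.
  rewrite -[S0 x]addr0.
  (* split off the change of kernel from the change of function *)
  have -> : S ^~ x = fun n => \int[mu]_y (u_ n y * K (x, y)) +
      \int[mu]_y (u_ n y * (K_ n (x, y) - K (x, y))).
    apply/funext => n; rewrite -RintegralD//; last 2 first.
    - exact: Lfun2M_integrable.
    - by apply: Lfun2M_integrable => //; exact: Lfun2B.
    by apply: eq_Rintegral => y _; rewrite -mulrDr addrC subrK.
  apply: cvgD; first exact: uu.
  apply/norm_cvg0P; apply: (@squeeze_cvgr _ _ _ _ (cst 0)
    (fun n => Num.sqrt M * Num.sqrt (\int[mu]_y ((K_ n (x, y) - K (x, y)) ^+ 2)))).
  - apply: nearW => n; rewrite normr_ge0/=; apply: normr_Rintegral_mul_le => //.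
    + exact: Lfun2B.
    + by rewrite sqr_sqrtr.
    + by rewrite sqr_sqrtr// Rintegral_ge0// => y _; exact: sqr_ge0.
  - exact: cvg_cst.
  - rewrite -[X in _ --> X](mulr0 (Num.sqrt M)) -[X in _ * X](@sqrtr0 R).
    apply: cvgM; first exact: cvg_cst.
    by apply: continuous_cvg; [exact: sqrt_continuous|exact: KK].
have SM n x : S n x ^+ 2 <= M * h x by exact: kernel_op_sqr_le.
have S0M x : S0 x ^+ 2 <= M * h x.
  have cv : S n x ^+ 2 @[n --> \oo] --> S0 x ^+ 2.
    by rewrite expr2; under eq_fun do rewrite expr2; apply: cvgM; exact: SS0.
  rewrite -(cvg_lim _ cv)//; apply: limr_le; last by exact: nearW.
  by apply/cvg_ex; eexists; exact: cv.
have SS : \int[mu]_x ((S n x - S0 x) ^+ 2) @[n --> \oo] --> (0 : R).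
  have mS n := measurable_Lfun (S2 n); have mS0 := measurable_Lfun S02.
  have [|||||_] := @Rintegral_dominated_cvg _ _ _ mu
    (fun n x => (S n x - S0 x) ^+ 2) (cst 0) (fun x => 4 * M * h x).
  - by move=> n; apply: measurable_funX; exact: measurable_funB.
  - exact: measurable_cst.
  - apply: nearW => x; rewrite -[X in _ --> X](expr0n R 2) -(subrr (S0 x)) expr2.
    under eq_fun do rewrite expr2.
    by apply: cvgM; apply: cvgB => //; exact: cvg_cst.
  - exact: (integrableZl measurableT (4 * M) hi).
  - apply: nearW => x n; rewrite ger0_norm ?sqr_ge0//.
    (* (a - b)^2 <= 2 a^2 + 2 b^2 *)
    have := SM n x; have := S0M x; have := sqr_ge0 (S n x + S0 x); nra.
  - by rewrite Rintegral_cst// mul0r.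
rewrite (kernel_formE Kh u2) -/S0 -[X in _ --> X]addr0.
have -> : (fun n => kernel_form (K_ n) (u_ n)) = fun n =>
   \int[mu]_x (u_ n x * S0 x) + \int[mu]_x (u_ n x * (S n x - S0 x)).
  apply/funext => n; rewrite (kernel_formE (K_h n) (u_2 n)) -/(S n).
  rewrite -RintegralD//; last 2 first.
  - exact: Lfun2M_integrable.
  - by apply: Lfun2M_integrable => //; exact: Lfun2B.
  by apply: eq_Rintegral => y _; rewrite -mulrDr addrC subrK.
apply: cvgD; first exact: uu.
apply/norm_cvg0P; apply: (@squeeze_cvgr _ _ _ _ (cst 0)
    (fun n => Num.sqrt M * Num.sqrt (\int[mu]_x ((S n x - S0 x) ^+ 2)))).
- apply: nearW => n; rewrite normr_ge0/=; apply: normr_Rintegral_mul_le => //.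
  + exact: Lfun2B.
  + by rewrite sqr_sqrtr.
  + by rewrite sqr_sqrtr// Rintegral_ge0// => y _; exact: sqr_ge0.
- exact: cvg_cst.
- rewrite -[X in _ --> X](mulr0 (Num.sqrt M)) -[X in _ * X](@sqrtr0 R).
  apply: cvgM; first exact: cvg_cst.
  by apply: continuous_cvg; [exact: sqrt_continuous|exact: SS].
Qed.

End quadratic_forms.

(** * Lebesgue measure and Euclidean distance on row vectors *)

Section euclidean.
Context (R : realType) (n : nat).
Implicit Types (x y : 'rV[R]_n) (A : set 'rV[R]_n).

(** An open set is a countable union of cubes with rational centres and radii
    1 / (k + 1). *)
Lemma open_measurable_rV A : open A -> measurable A.
Proof.
move=> oA.
pose box (p : 'rV[rat]_n * nat) : set 'rV[R]_n :=
  [set y | forall i, ball (ratr (p.1 ord0 i) : R) p.2.+1%:R^-1 (y ord0 i)].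
pose F p := if pselect (box p `<=` A) then box p else set0.
have -> : A = \bigcup_p F p.
  apply/seteqP; split=> [x Ax|x [p _]]; last first.
    by rewrite /F; case: pselect => // pA; exact: pA.
  have := oA; rewrite openE => /(_ x Ax) /nbhs_ballP[e /= e0 xeA].
  (* half of e: a cube of radius 1 / (k + 1) that contains x but is not centred
     at x must still lie in the ball *)
  have [k] := near_infty_natSinv_lt (PosNum (divr_gt0 e0 (ltr0n R 2))).
  move=> _ /(_ k (leqnn k)) /= ke.
  have k0 : 0 < k.+1%:R^-1 :> R by rewrite invr_gt0.
  have rq i : exists q : rat, ball (ratr q : R) k.+1%:R^-1 (x ord0 i).
    have [|q] := @rat_in_itvoo R (x ord0 i - k.+1%:R^-1) (x ord0 i + k.+1%:R^-1).
      by rewrite ltrD2l gtrN.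
    rewrite in_itv/= => /andP[q1 q2]; exists q.
    rewrite /ball/= ltr_norml; move: k.+1%:R^-1 q1 q2 => c q1 q2.
    by apply/andP; split; lra.
  have [q qP] := choice rq.
  have boxA : box (\row_i q i, k) `<=` A.
    move=> y yb; apply: xeA; split => // i j; rewrite ord1.
    have := yb j; have := qP j; rewrite /= mxE /ball/= !ltr_norml.
    move: k.+1%:R^-1 ke => c ke.
    by move=> /andP[? ?] /andP[? ?]; apply/andP; split; lra.
  exists (\row_i q i, k) => //; rewrite /F; case: pselect => // _ i /=.
  by rewrite mxE.
apply: countable_bigcupT_measurable => [|p]; first exact: countableP.
rewrite /F; case: pselect => /= [_|_]; last exact: measurable0.
apply: (@measurable_rV_box _ _ _ (fun i => ball (ratr (p.1 ord0 i) : R) p.2.+1%:R^-1)) => i.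
exact: measurable_ball.
Qed.

Lemma measurable_eucl_dist :
  measurable_fun setT (fun p : 'rV[R]_n * 'rV[R]_n => eucl_dist p.1 p.2).
Proof.
refine (@measurableT_comp _ _ _ _ _ _ (Num.sqrt : R -> R) _
  (fun p : 'rV[R]_n * 'rV[R]_n =>
    \sum_(i < n) (p.1 ord0 i - p.2 ord0 i) ^+ 2) _ _).
  by apply: continuous_measurable_fun; exact: sqrt_continuous.
apply: measurable_sum => i; apply: measurable_funX; apply: measurable_funB.
- exact: (measurableT_comp (measurable_rV_coord i) measurable_fst).
- exact: (measurableT_comp (measurable_rV_coord i) measurable_snd).
Qed.

Lemma coord_le_eucl_dist x y i : `|x ord0 i - y ord0 i| <= eucl_dist x y.
Proof.
rewrite -ler_sqr ?nnegrE ?sqrtr_ge0// sqr_sqrtr; last first.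
  by apply: sumr_ge0 => j _; exact: sqr_ge0.
rewrite real_normK ?num_real// (bigD1 i)//= lerDl.
by apply: sumr_ge0 => j _; exact: sqr_ge0.
Qed.

Lemma eucl_dist_eq0 x y : eucl_dist x y = 0 -> x = y.
Proof.
move=> d0; apply/rowP => i; apply/eqP; rewrite -subr_eq0 -normr_le0 -d0.
exact: coord_le_eucl_dist.
Qed.

Lemma eucl_dist_le x y (r : R) :
  (forall i, `|x ord0 i - y ord0 i| <= r) ->
  eucl_dist x y <= Num.sqrt (n%:R * r ^+ 2).
Proof.
move=> xyr; apply: ler_wsqrtr.
apply: (@le_trans _ _ (\sum_(i < n) r ^+ 2)).
  apply: ler_sum => i _; rewrite -real_normK ?num_real//.
  by apply: lerXn2r (xyr i); rewrite nnegrE// (le_trans _ (xyr i)).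
by rewrite sumr_const card_ord mulr_natl.
Qed.

Lemma bounded_set_rV A : bounded_set A ->
  
  exists2 B : R, 0 < B & forall x, A x -> forall i, `|x ord0 i| <= B.
Proof.
move=> [M [_ MA]]; exists (`|M| + 1) => [|x Ax i]; first by rewrite ltr_wpDl.
have /MA/(_ x Ax) : M < `|M| + 1 by rewrite (le_lt_trans (ler_norm _))// ltrDl.
apply: le_trans.
rewrite [leRHS](@mx_normrE R 1 n x).
exact: (le_bigmax 0 (fun ij : 'I_1 * 'I_n => `|x ij.1 ij.2|) (ord0, i)).
Qed.

Lemma rV_set1E x : [set x] = [set y | forall i, [set x ord0 i] (y ord0 i)].
Proof. by apply/seteqP; split=> [y ->//|y /= yx]; exact/rowP. Qed.

Lemma measurable_rV_set1 x : measurable [set x].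
Proof.
rewrite rV_set1E.
by apply: (@measurable_rV_box _ _ _ (fun i => [set x ord0 i])) => i.
Qed.

Lemma lebesgue_rV_set1 x : (0 < n)%N -> lebesgue_rV n [set x] = 0%E.
Proof.
move=> n0; rewrite rV_set1E (@lebesgue_rV_box R n (fun i => [set x ord0 i]))//.
by rewrite (bigD1 (Ordinal n0))//= lebesgue_measure_set1 mul0e.
Qed.

(** The coordinate i0 carries the singularity of the kernels at y_i0 = a; with
    a = 0 and e = B the slab is the cube of side 2 * B. *)
Definition slab (i0 : 'I_n) (a B e : R) : set 'rV[R]_n :=
  [set y | forall i,
    y ord0 i \in (if i == i0 then `[a - e, a + e] else `[- B, B])].

Lemma measurable_slab i0 a B e : measurable (slab i0 a B e).
Proof.
apply: (@measurable_rV_box _ _ _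
  (fun i => [set` if i == i0 then `[a - e, a + e] else `[- B, B]])) => i.
exact: measurable_itv.
Qed.

Lemma lebesgue_rV_slab (i0 : 'I_n) (a B e : R) : 0 < e -> 0 < B ->
  lebesgue_rV n (slab i0 a B e) =
  (e *+ 2 * (B *+ 2) ^+ n.-1)%:E.
Proof.
move=> e0 B0; rewrite /slab.
have := @lebesgue_rV_box R n
  (fun i => [set` if i == i0 then `[a - e, a + e] else `[- B, B]]).
move=> ->; last by move=> i; exact: measurable_itv.
rewrite (bigD1 i0)//= eqxx lebesgue_measure_itv/= lte_fin.
rewrite ltrD2l gtrN// -EFinB.
rewrite (eq_bigr (fun=> (B *+ 2)%:E)); last first.
  move=> i /negbTE ->; rewrite lebesgue_measure_itv/= lte_fin gtrN// -EFinB.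
  by rewrite opprK.
rewrite prodEFin prodr_const -EFinM; congr ((_ * _)%:E); first by ring.
by congr (_ ^+ _); rewrite cardC1 card_ord.
Qed.

End euclidean.

(** * The logarithmic weight and its integral *)

Section singular_integral.
Context (R : realType) (n : nat).

(** For r > 0 this is the square root of max(r, 1 / r); at r = 0 it is 1, since
    ln 0 = 0. It bounds, up to a factor, the squares of the kernels
    considered below. *)
Definition log_weight (r : R) : R := expR (`|ln r| / 2).

(** Geometric decomposition of the singularity: either the weight is bounded,
    or r lies between e^(-2(k+1)) and e^(-2k) for the integer part k of
    - ln r / 2, and then the weight is at most e^(k+1). *)
Lemma log_weight_le r D : 0 <= r -> r <= D ->
  log_weight r <= 1 + D \/
  exists2 k : nat, r <= expR (- (2 * k%:R)) & log_weight r <= expR (k%:R + 1).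
Proof.
rewrite /log_weight => r0 rD; have [lr|lr] := leP 0 (ln r).
  left; rewrite ger0_norm//; move: r0 rD; rewrite le_eqVlt => /predU1P[<-|r0] rD.
    by rewrite ln0// mul0r expR0 lerDl.
  apply: (@le_trans _ _ (expR (ln r))); first by rewrite ler_expR; lra.
  by rewrite lnK ?posrE//; lra.
right; have rp : 0 < r.
  rewrite lt_neqAle r0 andbT; apply/eqP => r00.
  by move: lr; rewrite -r00 ln0// ltxx.
have tp : 0 <= - ln r / 2 by lra.
exists (Num.truncn (- ln r / 2)); have /andP[] := truncn_itv tp.
  by move=> kl _; rewrite -[leLHS](@lnK R r) ?posrE// ler_expR; lra.
by rewrite -natr1 => _ kl; rewrite ler_expR ltr0_norm//; lra.
Qed.

(** The points y at distance at most e^(-2k) of x lie in a slab of thickness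
    2 e^(-2k), whatever the dimension, where the weight e^(k+1) contributes at
    most a constant times e^(-k). These contributions form a geometric series
    whose sum does not depend on x. *)
Lemma integral_log_weight_le (Om : set 'rV[R]_n) :
  (0 < n)%N -> measurable Om -> bounded_set Om -> exists C : R, forall x, Om x ->
  (\int[lebesgue_rV n]_(y in Om) (log_weight (eucl_dist x y))%:E <= C%:E)%E.
Proof.
move=> n0 mO /bounded_set_rV[B B0 OB].
pose i0 := Ordinal n0.
pose D : R := Num.sqrt (n%:R * (B *+ 2) ^+ 2).
pose P := (B *+ 2) ^+ n.-1.
have P0 : 0 <= P by rewrite exprn_ge0// mulrn_wge0// ltW.
have D0 : 0 <= D by exact: sqrtr_ge0.
have e1 : expR (- 1) < 1 :> R by rewrite expR_lt1; lra.
have volE a e : 0 < e ->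
    (lebesgue_rV n : {measure set 'rV[R]_n -> \bar R}) (slab i0 a B e) =
    (e *+ 2 * P)%:E.
  by move=> e0; exact: lebesgue_rV_slab.
pose C1 : R := (1 + D) * (B *+ 2 * P).
pose C2 := (expR 1 *+ 2 * P) / (1 - expR (- 1)).
exists (C1 + C2) => x Ox.
pose s k := slab i0 (x ord0 i0) B (expR (- (2 * k%:R))).
have ms k : measurable (s k) by exact: measurable_slab.
pose t k (y : 'rV[R]_n) : \bar R := (expR (k%:R + 1) * \1_(s k) y)%:E.
have t0 k y : (0 <= t k y)%E by rewrite lee_fin mulr_ge0 ?expR_ge0.
have mt k : measurable_fun setT (t k).
  by apply/measurable_EFinP; apply: measurable_funM => //; exact: measurable_indic.
pose b := slab i0 0 B B.
have mb : measurable b by exact: measurable_slab.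
pose g (y : 'rV[R]_n) : \bar R := ((1 + D) * \1_b y)%:E.
have g0 y : (0 <= g y)%E by rewrite lee_fin mulr_ge0 ?addr_ge0.
have mg : measurable_fun setT g.
  by apply/measurable_EFinP; apply: measurable_funM => //; exact: measurable_indic.
pose G y := (g y + \sum_(0 <= k <oo) t k y)%E.
have T0 y : (0 <= \sum_(0 <= k <oo) t k y)%E by apply: nneseries_ge0.
have mTs : measurable_fun setT (fun y => \sum_(0 <= k <oo) t k y)%E.
  by apply: ge0_emeasurable_sum => // k y _ _; exact: t0.
have mG : measurable_fun setT G by exact: emeasurable_funD.
have G0 y : (0 <= G y)%E by apply: adde_ge0.
have wG y : Om y -> ((log_weight (eucl_dist x y))%:E <= G y)%E.
  move=> Oy.
  have dD : eucl_dist x y <= D.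
    apply: eucl_dist_le => i; apply: le_trans (ler_normB _ _) _.
    by rewrite mulr2n lerD//; exact: OB.
  have [wl|[k rk wl]] := log_weight_le (sqrtr_ge0 _) dD.
    apply: le_trans (leeDl _ (T0 y)).
    rewrite lee_fin indicE mem_set ?mulr1// => i.
    have := OB y Oy i; rewrite ler_norml => /andP[? ?].
    by case: ifP => _; rewrite in_itv/= ?add0r ?sub0r; apply/andP.
  apply: le_trans (leeDr _ (g0 y)).
  apply: le_trans (nneseries_lim_ge k.+1 _); last by move=> *; exact: t0.
  rewrite big_nat_recr//=; apply: (@le_trans _ _ (t k y)); last first.
    by apply: leeDr; apply: sume_ge0 => j _; exact: t0.
  rewrite lee_fin indicE mem_set ?mulr1// => i.
  case: ifP => [/eqP ->|_]; last first.
    by have := OB y Oy i; rewrite ler_norml in_itv.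
  have := le_trans (coord_le_eucl_dist x y i0) rk.
  by rewrite ler_norml in_itv/= => /andP[? ?]; apply/andP; split; lra.
have mw : measurable_fun setT (fun y => log_weight (eucl_dist x y)).
  rewrite /log_weight.
  have md : measurable_fun setT (eucl_dist x).
    exact: (measurableT_comp (@measurable_eucl_dist R n) (pair1_measurable x)).
  apply: (measurableT_comp (@measurable_expR R)).
  apply: measurable_funM => //; apply: measurableT_comp => //.
  exact: (measurableT_comp (@measurable_ln R) md).
apply: (@le_trans _ _ (\int[lebesgue_rV n]_y G y)%E).
  apply: (@le_trans _ _ (\int[lebesgue_rV n]_(y in Om) G y)%E).
    apply: ge0_le_integral => //.
    - by move=> y _; rewrite lee_fin expR_ge0.
    - by apply/measurable_EFinP; exact: measurable_funTS.
    - exact: measurable_funTS.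
  by apply: ge0_subset_integral.
rewrite ge0_integralD// EFinD; apply: leeD.
  rewrite /g (@integralZl_indic _ _ _ _ _ _ (fun=> b))//; last first.
    by move=> h; exfalso; move: h D0; lra.
  by rewrite integral_indic// setIT volE// -EFinM.
rewrite integral_nneseries//.
apply: lime_le; first by apply: is_cvg_nneseries => k _ _; exact: integral_ge0.
apply: nearW => N.
have Et k : (\int[lebesgue_rV n]_y t k y = (expR 1 *+ 2 * P * expR (-1) ^+ k)%:E)%E.
  rewrite /t (@integralZl_indic _ _ _ _ _ _ (fun=> s k))//; last first.
    by move=> h; exfalso; have := expR_ge0 (k%:R + 1 : R); rewrite leNgt h.
  rewrite integral_indic// setIT volE ?expR_gt0// -EFinM; congr EFin.
  have -> : expR (-1) ^+ k = expR (- k%:R) :> R by rewrite -expRM_natl mulrN1.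
  have E : expR (k%:R + 1) * expR (- (2 * k%:R)) = expR 1 * expR (- k%:R) :> R.
    by rewrite -!expRD; congr expR; ring.
  transitivity (expR (k%:R + 1) * expR (- (2 * k%:R)) *+ 2 * P).
    by ring.
  by rewrite E; ring.
under eq_bigr do rewrite Et.
rewrite sumEFin lee_fin.
apply: (@geometric_le_lim R N (expR 1 *+ 2 * P) (expR (-1))).
- by rewrite mulr_ge0// mulrn_wge0// expR_ge0.
- exact: expR_gt0.
- by rewrite ger0_norm ?expR_ge0.
Qed.

End singular_integral.

(** * Bounds on the Riesz quotients *)

Section exponential_bounds.
Context {R : realType}.
Implicit Types s r e : R.

(** Both this bound and the next one follow from 1 + s <= e^s applied to s and
    to - s. *)
Lemma normr_expR_sub1_le s : `|expR s - 1| <= `|s| * expR `|s|.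
Proof.
have [s0|s0] := leP 0 s.
  have es : 1 <= expR s by rewrite -(@expR0 R) ler_expR.
  rewrite !ger0_norm ?subr_ge0//.
  have := ler_wpM2l (expR_ge0 s) (expR_ge1Dx (- s)).
  by rewrite -expRD subrr expR0; lra.
have es : expR s <= 1 by rewrite -(@expR0 R) ler_expR ltW.
rewrite (ltr0_norm s0) ler0_norm ?subr_le0//.
have e1 : 1 <= expR (- s) by rewrite -(@expR0 R) ler_expR; lra.
have := expR_ge1Dx s; have : - s <= - s * expR (- s) by rewrite ler_peMr//; lra.
by lra.
Qed.

Lemma normr_expR_sub1_sub_le s : `|s| <= 2^-1 ->
  `|expR s - 1 - s| <= 2 * s ^+ 2.
Proof.
rewrite ler_norml => /andP[s1 s2].
have ge := expR_ge1Dx s.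
rewrite ger0_norm; last by lra.
have := ler_wpM2l (expR_ge0 s) (expR_ge1Dx (- s)).
rewrite -expRD subrr expR0 => le1.
have : 0 < expR s by exact: expR_gt0.
nra.
Qed.

(** For r > 0 this is (r^-e - 1) / e; at r = 0 it is 0, since ln 0 = 0. *)
Definition riesz_quotient e r := e^-1 * (expR (- e * ln r) - 1).

Lemma exp_ln_sqr_le e r : 0 < e -> e <= 4^-1 ->
  expR (- e * ln r) ^+ 2 <= log_weight r.
Proof.
move=> e0 e4; rewrite -expRM_natl ler_expR.
have : - e * ln r <= e * `|ln r|.
  by rewrite (le_trans (ler_norm _))// normrM normrN (gtr0_norm e0).
have := normr_ge0 (ln r); nra.
Qed.

Lemma log_weight_ge1 r : 1 <= log_weight r.
Proof. by rewrite -(@expR0 R) ler_expR divr_ge0. Qed.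

Lemma ln_le_expR8 r : `|ln r| <= 8 * expR (`|ln r| / 8).
Proof. by have := expR_ge1Dx (`|ln r| / 8); lra. Qed.

(** With L = |ln r|, the quotient is at most L e^(eL), where L <= 8 e^(L/8) and
    e <= 1/8; so its square is at most 64 e^(L/2), uniformly in e. *)
Lemma riesz_quotient_sqr_le e r : 0 < e -> e <= 8^-1 ->
  riesz_quotient e r ^+ 2 <= 64 * log_weight r.
Proof.
move=> e0 e8.
have L0 := normr_ge0 (ln r).
have le1 : `|riesz_quotient e r| <= 8 * expR (`|ln r| / 4).
  rewrite /riesz_quotient normrM gtr0_norm ?invr_gt0// ler_pdivrMl//.
  apply: le_trans (normr_expR_sub1_le _) _.
  rewrite normrM normrN (gtr0_norm e0) -mulrA ler_pM2l//.
  have -> : `|ln r| / 4 = `|ln r| / 8 + `|ln r| / 8 by field.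
  rewrite expRD mulrA; apply: ler_pM; rewrite ?expR_ge0 ?ln_le_expR8//.
  by rewrite ler_expR mulrC ler_wpM2l.
rewrite -real_normK ?num_real//.
apply: (@le_trans _ _ ((8 * expR (`|ln r| / 4)) ^+ 2)).
  by apply: lerXn2r => //; rewrite nnegrE mulr_ge0// expR_ge0.
rewrite exprMn -expRM_natl /log_weight.
have -> : 2%:R * (`|ln r| / 4) = `|ln r| / 2 by field.
by rewrite ler_wpM2r ?expR_ge0//; lra.
Qed.

Lemma ln_sqr_le r : (- ln r) ^+ 2 <= 64 * log_weight r.
Proof.
rewrite sqrrN -real_normK ?num_real//.
apply: (@le_trans _ _ ((8 * expR (`|ln r| / 8)) ^+ 2)).
  by apply: lerXn2r; rewrite ?nnegrE ?mulr_ge0 ?expR_ge0 ?ln_le_expR8.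
rewrite exprMn -expRM_natl /log_weight.
apply: ler_pM; rewrite ?expR_ge0 ?exprn_ge0//; first by lra.
by rewrite ler_expR; have := normr_ge0 (ln r); lra.
Qed.

Lemma riesz_quotient_cvg (e_ : nat -> R) r : (forall n, 0 < e_ n) ->
  e_ @ \oo --> (0 : R) -> riesz_quotient (e_ n) r @[n --> \oo] --> - ln r.
Proof.
move=> e0 ec; apply/subr_cvg0.
apply/norm_cvg0P; apply: (@squeeze_cvgr _ _ _ _ (cst 0)
  (fun n => e_ n * (2 * (- ln r) ^+ 2))); last 2 first.
- exact: cvg_cst.
- rewrite -[X in _ --> X](mul0r (2 * (- ln r) ^+ 2)).
  by apply: cvgM => //; exact: cvg_cst.
have es : e_ n * `|ln r| @[n --> \oo] --> (0 : R).
  by rewrite -[X in _ --> X](mul0r `|ln r|); apply: cvgM => //; exact: cvg_cst.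
have /cvgr_lt/(_ 2^-1) := es; rewrite invr_gt0 ltr0n => /(_ isT).
apply: filterS => n nle; rewrite normr_ge0/=.
have en := e0 n.
have -> : riesz_quotient (e_ n) r - - ln r =
    (e_ n)^-1 * (expR (- e_ n * ln r) - 1 - (- e_ n * ln r)).
  by rewrite /riesz_quotient; field; rewrite gt_eqF.
rewrite normrM gtr0_norm ?invr_gt0// ler_pdivrMl//.
apply: le_trans (normr_expR_sub1_sub_le _) _.
  by rewrite normrM normrN (gtr0_norm en) ltW.
by rewrite le_eqVlt; apply/orP; left; apply/eqP; ring.
Qed.

End exponential_bounds.

(** * Radial kernels on a bounded set *)

Lemma restrict_mul_indic (T : Type) (R : realType) (A : set T) (f : T -> R) x :
  (f \_ A) x = f x * \1_A x.
Proof. by rewrite patchE indicE; case: ifPn => _ /=; rewrite ?mulr1 ?mulr0. Qed.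

Section radial_kernels.
Context (R : realType) (n : nat) (Om : set 'rV[R]_n).
Hypotheses (n0 : (0 < n)%N) (mO : measurable Om) (bO : bounded_set Om).
Notation mu := (@lebesgue_rV R n).
Implicit Types (f : R -> R) (u : 'rV[R]_n -> R).

(** The indicators make the domain part of the kernel: integrals over Om become
    integrals over the whole space, where functions of L2(Om) are extended by 0. *)
Definition radial_kernel f (p : 'rV[R]_n * 'rV[R]_n) : R :=
  \1_Om p.1 * \1_Om p.2 * f (eucl_dist p.1 p.2).

Lemma measurable_radial_kernel f : measurable_fun setT f ->
  measurable_fun setT (radial_kernel f).
Proof.
move=> mf; have m1 : measurable_fun setT (\1_Om : _ -> R) by exact: measurable_indic.
apply: measurable_funM.
  apply: measurable_funM.
    exact: (measurableT_comp m1 measurable_fst).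
  exact: (measurableT_comp m1 measurable_snd).
exact: (measurableT_comp mf (@measurable_eucl_dist R n)).
Qed.

Lemma measurable_radial_kernel_pair1 f x : measurable_fun setT f ->
  measurable_fun setT (fun y => radial_kernel f (x, y)).
Proof.
move=> /measurable_radial_kernel mf.
exact: (measurableT_comp mf (pair1_measurable x)).
Qed.

Lemma measurable_log_weight : measurable_fun setT (@log_weight R).
Proof.
apply: (measurableT_comp (@measurable_expR R)).
by apply: measurable_funM => //; apply: measurableT_comp => //; exact: measurable_ln.
Qed.

Lemma lebesgue_rV_bounded_lty : (mu Om < +oo)%E.
Proof.
have [B B0 OB] := bounded_set_rV bO.
apply: (@le_lt_trans _ _ (mu (slab (Ordinal n0) 0 B B))); last first.
  by rewrite lebesgue_rV_slab// ltry.
apply: le_measure; rewrite ?inE//; first exact: measurable_slab.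
move=> y Oy i; have := OB y Oy i; rewrite ler_norml => /andP[? ?].
by case: ifP => _; rewrite in_itv/= ?add0r ?sub0r; apply/andP.
Qed.

Lemma indic_integrable : mu.-integrable setT (EFin \o (\1_Om : _ -> R)).
Proof.
apply/integrableP; split.
  by apply/measurable_EFinP; exact: measurable_indic.
under eq_integral do rewrite /= ger0_norm//.
by rewrite integral_indic// setIT lebesgue_rV_bounded_lty.
Qed.

Lemma log_weight_integrable : exists2 C : R, 0 <= C & forall x,
  mu.-integrable setT (EFin \o (fun y => radial_kernel (@log_weight R) (x, y))) /\
  \int[mu]_y radial_kernel (@log_weight R) (x, y) <= C * \1_Om x.
Proof.
have [C CP] := integral_log_weight_le n0 mO bO.
exists `|C| => // x.
have mW := measurable_radial_kernel_pair1 x measurable_log_weight.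
have W0 y : 0 <= radial_kernel (@log_weight R) (x, y).
  by rewrite !mulr_ge0// expR_ge0.
have le : (\int[mu]_y (radial_kernel (@log_weight R) (x, y))%:E <=
    (`|C| * \1_Om x)%:E)%E.
  have [Ox|Ox] := pselect (Om x); last first.
    rewrite /radial_kernel/= indicE memNset// mulr0.
    by under eq_integral do rewrite !mul0r; rewrite integral0.
  rewrite indicE mem_set// mulr1.
  apply: le_trans (le_trans (CP x Ox) _); last by rewrite lee_fin ler_norm.
  rewrite [leRHS]integral_mkcond.
  rewrite le_eqVlt; apply/orP; left; apply/eqP; apply: eq_integral => y _.
  rewrite restrict_EFin/= restrict_mul_indic /radial_kernel/= [X in X * _ * _]indicE.
  by rewrite mem_set// mul1r mulrC.
have Wi : mu.-integrable setT
    (EFin \o (fun y => radial_kernel (@log_weight R) (x, y))).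
  apply/integrableP; split; first exact/measurable_EFinP.
  under eq_integral do rewrite /= ger0_norm//.
  by apply: le_lt_trans le _; rewrite ltry.
split => //; rewrite -lee_fin; apply: le_trans le.
by rewrite /Rintegral fineK//; exact: (integrable_fin_num measurableT Wi).
Qed.

(** One integrable bound h serves for all profiles f, in particular for the
    whole family riesz_quotient e with e <= 1/8; it is a constant on Om because
    the integral of the weight is bounded uniformly in x. *)
Lemma radial_kernel_L2 : exists2 h : 'rV[R]_n -> R,
  mu.-integrable setT (EFin \o h) &
  forall f, measurable_fun setT f -> (forall r, f r ^+ 2 <= 64 * log_weight r) ->
  L2_kernel mu h (radial_kernel f).
Proof.
have [C C0 CP] := log_weight_integrable.
exists (fun x => 64 * (C * \1_Om x)).
  have := integrableZl measurableT (64 * C) indic_integrable.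
  by congr integrable; apply/funext => x /=; rewrite -EFinM mulrA.
move=> f mf fw; split=> [|x]; first exact: measurable_radial_kernel.
have [Wi Wle] := CP x.
have W64 := integrableZl measurableT 64 Wi.
have Kle y : radial_kernel f (x, y) ^+ 2 <=
    64 * radial_kernel (@log_weight R) (x, y).
  rewrite /radial_kernel !indicE; case: (_ \in _); case: (_ \in _) => /=;
    rewrite ?(mul1r, mul0r, mulr0, expr0n)//=.
have K2 : (fun y => radial_kernel f (x, y)) \in Lfun mu 2%:E.
  have mK := measurable_radial_kernel_pair1 x mf.
  apply: sqr_integrable_Lfun2 => //; apply: (le_integrable measurableT _ _ W64) => [|y _].
    by apply/measurable_EFinP; exact: measurable_funX.
  by rewrite /= lee_fin ger0_norm ?sqr_ge0// (le_trans (Kle y))// ler_norm.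
split => //; apply: le_trans (ler_wpM2l _ Wle) => //.
rewrite -RintegralZl//; apply: le_Rintegral => //.
exact: Lfun2_integrable_sqr.
Qed.

Lemma radial_kernel_cvg (f_ : nat -> R -> R) f x :
  (forall k, measurable_fun setT (f_ k)) -> measurable_fun setT f ->
  (forall k r, f_ k r ^+ 2 <= 64 * log_weight r) ->
  (forall r, f r ^+ 2 <= 64 * log_weight r) ->
  (forall r, f_ k r @[k --> \oo] --> f r) ->
  \int[mu]_y ((radial_kernel (f_ k) (x, y) - radial_kernel f (x, y)) ^+ 2)
    @[k --> \oo] --> (0 : R).
Proof.
move=> mf_ mf f_w fw ff; have [C C0 CP] := log_weight_integrable.
have [|||||_] := @Rintegral_dominated_cvg _ _ _ mu
  (fun k y => (radial_kernel (f_ k) (x, y) - radial_kernel f (x, y)) ^+ 2)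
  (cst 0)
  (fun y => 256 * radial_kernel (@log_weight R) (x, y)).
- move=> k; apply: measurable_funX.
  by apply: measurable_funB; exact: measurable_radial_kernel_pair1.
- exact: measurable_cst.
- apply: nearW => y; rewrite -[X in _ --> X](expr0n R 2).
  rewrite -(subrr (radial_kernel f (x, y))) expr2; under eq_fun do rewrite expr2.
  by apply: cvgM; apply: cvgB;
    (apply: cvgM; [exact: cvg_cst|exact: ff]) || exact: cvg_cst.
- exact: (integrableZl measurableT 256 (CP x).1).
- apply: nearW => y k; rewrite ger0_norm ?sqr_ge0// /radial_kernel/=.
  (* (a - b)^2 <= 2 a^2 + 2 b^2 <= 256 * log_weight *)
  have := f_w k (eucl_dist x y); have := fw (eucl_dist x y).
  have := sqr_ge0 (f_ k (eucl_dist x y) + f (eucl_dist x y)).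
  rewrite !indicE; case: (_ \in _); case: (_ \in _) => /=;
    rewrite ?(mul1r, mul0r, mulr0, subrr, expr0n)//=; nra.
- by rewrite Rintegral_cst// mul0r.
Qed.

End radial_kernels.

(** * The renormalised Riesz functionals *)

Section functionals.
Context (R : realType) (n : nat) (Om : set 'rV[R]_n).
Hypotheses (n0 : (0 < n)%N) (mO : measurable Om) (bO : bounded_set Om).
Notation mu := (@lebesgue_rV R n).
Implicit Types (u v : 'rV[R]_n -> R) (f : R -> R).

(** The equality between k and the radial profile may fail on the diagonal,
    where both formulas take conventional values: for each x only the null set
    of the y equal to x is concerned. *)
Lemma kernel_form_restrict (k : 'rV[R]_n -> 'rV[R]_n -> R) f u :
  L2 Om u -> (forall x, measurable_fun setT (k x)) -> measurable_fun setT f ->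
  (forall x y, x != y -> k x y = f (eucl_dist x y)) ->
  \int[mu]_(x in Om) \int[mu]_(y in Om) (u x * u y * k x y) =
  kernel_form mu (radial_kernel Om f) (u \_ Om).
Proof.
rewrite /L2/= inE => /measurable_Lfun mU mk mf kf.
have ms x : measurable_fun setT (fun y => radial_kernel Om f (x, y)).
  exact: measurable_radial_kernel_pair1.
rewrite Rintegral_mkcond; apply: eq_Rintegral => x _.
rewrite restrict_mul_indic [X in X * _]Rintegral_mkcond.
have [Ox|Ox] := pselect (Om x); last first.
  rewrite indicE memNset// mulr0 restrict_mul_indic indicE memNset// mulr0.
  by under eq_Rintegral do rewrite !mul0r; rewrite Rintegral_cst// mul0r.
rewrite indicE mem_set// mulr1; congr fine.
apply: ae_eq_integral => //.
- apply/measurable_EFinP.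
  have -> : (fun y => u x * u y * k x y) \_ Om =
      fun y => u x * (u \_ Om) y * k x y.
    by apply/funext => y; rewrite !restrict_mul_indic; ring.
  by apply: measurable_funM => //; apply: measurable_funM.
- by apply/measurable_EFinP; apply: measurable_funM => //; exact: measurable_funM.
exists [set x]; split; first exact: measurable_rV_set1.
  exact: lebesgue_rV_set1.
move=> y /= yx; apply: contrapT => /eqP; rewrite eq_sym => xy; apply: yx => _.
congr EFin; rewrite !restrict_mul_indic kf// /radial_kernel/=.
rewrite [\1_Om x]indicE mem_set//= indicE.
by case: (_ \in _) => /=; ring.
Qed.

Lemma JE a u : 0 < n%:R - a -> L2 Om u ->
  J Om a u = - kernel_form mu
    (radial_kernel Om (fun r => expR (- (n%:R - a) * ln r))) (u \_ Om).
Proof.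
move=> e0 u2; congr (- _); apply: (kernel_form_restrict u2).
- move=> x; apply: (@eq_measurable_fun _ _ _ _ _
    (fun y => eucl_dist x y `^ (- (n%:R - a)))) => [y _|]; first by rewrite powRN.
  apply: (measurableT_comp (@measurable_powR R _)).
  exact: (measurableT_comp (@measurable_eucl_dist R n) (pair1_measurable x)).
- apply: (measurableT_comp (@measurable_expR R)).
  by apply: measurable_funM => //; exact: measurable_ln.
- move=> x y xy; rewrite -powRN /powR ifF//.
  by apply/negbTE; apply: contra xy => /eqP/eucl_dist_eq0/eqP.
Qed.

Lemma JtildedE u : L2 Om u ->
  Jtilded Om u = - kernel_form mu (radial_kernel Om (fun r => - ln r)) (u \_ Om).
Proof.
move=> u2; congr (- _).
have lnE x y : ln (1 / eucl_dist x y) = - ln (eucl_dist x y).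
  have := sqrtr_ge0 (\sum_i (x ord0 i - y ord0 i) ^+ 2).
  rewrite -/(eucl_dist x y) div1r le_eqVlt => /predU1P[<-|]; last exact: lnV.
  by rewrite invr0 ln0// oppr0.
have ml : measurable_fun setT (fun r : R => - ln r).
  by apply: measurableT_comp => //; exact: measurable_ln.
apply: (kernel_form_restrict u2) => // x; under eq_fun do rewrite lnE.
apply: (measurableT_comp ml).
exact: (measurableT_comp (@measurable_eucl_dist R n) (pair1_measurable x)).
Qed.

(** The square of the integral is the quadratic form of the constant kernel 1,
    to be subtracted from the Riesz kernel. *)
Lemma JdE u : L2 Om u ->
  Jd Om u = - kernel_form mu (radial_kernel Om (cst 1)) (u \_ Om).
Proof.
move=> u2; congr (- _).
have U2 : u \_ Om \in Lfun mu 2%:E by move: u2; rewrite /L2/= inE.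
have Ui : mu.-integrable setT (EFin \o u \_ Om).
  have I2 : (\1_Om : _ -> R) \in Lfun mu 2%:E.
    apply: sqr_integrable_Lfun2; first exact: measurable_indic.
    have := indic_integrable n0 mO bO; congr integrable; apply/funext => x /=.
    by rewrite indicE; case: (_ \in _); rewrite ?expr1n ?expr0n.
  have := Lfun2M_integrable U2 I2; congr integrable; apply/funext => x /=.
  by rewrite restrict_mul_indic indicE; case: (_ \in _); rewrite ?mulr1 ?mulr0.
rewrite expr2 Rintegral_mkcond -RintegralZr//; apply: eq_Rintegral => x _.
rewrite -RintegralZl//; apply: eq_Rintegral => y _.
rewrite !restrict_mul_indic /radial_kernel/= !indicE.
by case: (_ \in _); case: (_ \in _); rewrite /=; ring.
Qed.

Lemma JtildeE a u : 0 < n%:R - a -> n%:R - a <= 8^-1 -> L2 Om u ->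
  Jtilde Om a u =
  - kernel_form mu (radial_kernel Om (riesz_quotient (n%:R - a))) (u \_ Om).
Proof.
move=> e0 e8 u2.
have U2 : u \_ Om \in Lfun mu 2%:E by move: u2; rewrite /L2/= inE.
rewrite /Jtilde JE// JdE//.
have [h hi hK] := radial_kernel_L2 n0 mO bO.
set e := n%:R - a in e0 e8 *.
have mE : measurable_fun setT (fun r : R => expR (- e * ln r)).
  apply: (measurableT_comp (@measurable_expR R)).
  by apply: measurable_funM => //; exact: measurable_ln.
have KE : radial_kernel Om (riesz_quotient e) = fun p => e^-1 *
   (radial_kernel Om (fun r => expR (- e * ln r)) p - radial_kernel Om (cst 1) p).
  by apply/funext => p; rewrite /radial_kernel /riesz_quotient /=; ring.
have W1 (r : R) : 1 <= 64 * log_weight r by have := @log_weight_ge1 R r; lra.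
rewrite KE (kernel_formB hi)//; first by ring.
- apply: hK => // r; apply: (@le_trans _ _ (log_weight r)).
    by apply: exp_ln_sqr_le => //; lra.
  by have := @log_weight_ge1 R r; lra.
- by apply: hK => // r; rewrite expr1n.
- rewrite -KE; apply: hK => [|r]; last exact: riesz_quotient_sqr_le.
  by apply: measurable_funM => //; apply: measurable_funB.
Qed.

Lemma weakly_cvg_restrict un u : weakly_cvg Om un u ->
  forall v, v \in Lfun mu 2%:E ->
  \int[mu]_x ((un k \_ Om) x * v x) @[k --> \oo] -->
  \int[mu]_x ((u \_ Om) x * v x).
Proof.
move=> uw v v2.
have E (w : 'rV[R]_n -> R) :
    \int[mu]_x ((w \_ Om) x * v x) = \int[mu]_(x in Om) (w x * v x).
  rewrite [RHS]Rintegral_mkcond; apply: eq_Rintegral => x _.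
  by rewrite !restrict_mul_indic mulrAC.
rewrite E; under eq_fun do rewrite E; apply: uw.
rewrite /L2/= inE; have mv := measurable_Lfun v2.
have mvO : measurable_fun setT (v \_ Om).
  by apply/(measurable_restrictT _ mO); exact: measurable_funTS.
apply: sqr_integrable_Lfun2 => //.
apply: (le_integrable measurableT _ _ (Lfun2_integrable_sqr v2)) => [|x _].
  by apply/measurable_EFinP; exact: measurable_funX.
rewrite /= lee_fin !ger0_norm ?sqr_ge0// restrict_mul_indic indicE.
by case: (_ \in _); rewrite ?mulr1// mulr0 expr0n/= sqr_ge0.
Qed.

(** The uniform bound on the kernels needs e <= 1/8, which holds only for large
    indices; the sequence e' satisfies it everywhere and agrees with e from some
    index on. *)
Lemma Jtilde_cvg an u un : @admissible R n an -> L2 Om u ->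
  (forall k, L2 Om (un k)) -> weakly_cvg Om un u ->
  Jtilde Om (an k) (un k) @[k --> \oo] --> Jtilded Om u.
Proof.
move=> [a0 ac] u2 un2 uw.
pose e k := n%:R - an k.
have e0 k : 0 < e k by rewrite subr_gt0; have /andP[] := a0 k.
have ec : e @ \oo --> (0 : R).
  rewrite -(subrr (n%:R : R)); apply: cvgB; first exact: cvg_cst.
  by apply: cvg_trans ac _; exact: cvg_within.
pose e' k := Num.min (e k) 8^-1.
have e'0 k : 0 < e' k by rewrite /e' lt_min e0/= invr_gt0.
have ee' : \forall k \near \oo, e k <= 8^-1.
  by have /cvgr_le/(_ 8^-1) := ec; apply; rewrite invr_gt0.
have e'e : \forall k \near \oo, e' k = e k by apply: filterS ee' => k /min_idPl.
have e'c : e' @ \oo --> (0 : R).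
  apply: cvg_trans ec; apply: near_eq_cvg; apply: filterS e'e => k //.
have [h hi hK] := radial_kernel_L2 n0 mO bO.
have mq x : measurable_fun setT (@riesz_quotient R x).
  apply: measurable_funM => //; apply: measurable_funB => //.
  apply: (measurableT_comp (@measurable_expR R)).
  by apply: measurable_funM => //; exact: measurable_ln.
have ml : measurable_fun setT (fun r : R => - ln r).
  by apply: measurableT_comp => //; exact: measurable_ln.
have qb k r : riesz_quotient (e' k) r ^+ 2 <= 64 * log_weight r.
  by apply: riesz_quotient_sqr_le => //; rewrite /e' ge_min lexx orbT.
have cv : kernel_form mu (radial_kernel Om (riesz_quotient (e' k)))
      (un k \_ Om) @[k --> \oo] -->
    kernel_form mu (radial_kernel Om (fun r => - ln r)) (u \_ Om).
  apply: (kernel_form_cvg hi).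
  - by move=> k; apply: hK.
  - by apply: hK => // r; exact: ln_sqr_le.
  - move=> x; apply: radial_kernel_cvg => // r; first exact: ln_sqr_le.
    exact: riesz_quotient_cvg.
  - by move=> k; have := un2 k; rewrite /L2/= inE.
  - by move: u2; rewrite /L2/= inE.
  - exact: weakly_cvg_restrict.
have {}cv : - kernel_form mu (radial_kernel Om (riesz_quotient (e' k)))
      (un k \_ Om) @[k --> \oo] --> Jtilded Om u by rewrite JtildedE//; exact: cvgN cv.
apply: cvg_trans cv; apply: near_eq_cvg; near=> k => /=.
have -> : e' k = e k by near: k.
apply/esym/JtildeE; [exact: e0| |exact: un2].
by near: k; exact: ee'.
Unshelve. all: by end_near. Qed.

End functionals.

(** Convergence along all weakly convergent sequences gives the lower bound,
    and the constant sequence is a recovery sequence. *)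
Lemma continuous_cvg_Gamma (R : realType) (n : nat) (Om : set 'rV[R]_n)
    (F : R -> ('rV[R]_n -> R) -> R) (G : ('rV[R]_n -> R) -> R) :
  (forall an u un, @admissible R n an -> L2 Om u -> (forall k, L2 Om (un k)) ->
    weakly_cvg Om un u -> F (an k) (un k) @[k --> \oo] --> G u) ->
  Gamma_cvg Om F G.
Proof.
move=> FG an aan; split=> [u un u2 un2 uw|u u2].
  have cv : (F (an k) (un k))%:E @[k --> \oo] --> (G u)%:E.
    by apply: cvg_EFin; [exact: nearW|exact: (FG an u un)].
  by rewrite (cvg_limn_einf_sup cv).1.
have uw : weakly_cvg Om (fun=> u) u by move=> v _; exact: cvg_cst.
by exists (fun=> u); split => //; exact: FG.
Qed.

Theorem theorem3p4 (R : realType) (d : nat) (Om : set 'rV[R]_d) :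
  (0 < d)%N -> open Om -> bounded_set Om -> lipschitz_boundary Om ->
  [/\ forall an, @admissible R d an ->
        forall (u : 'rV[R]_d -> R) (un : nat -> 'rV[R]_d -> R),
          L2 Om u -> (forall n, L2 Om (un n)) -> weakly_cvg Om un u ->
          Jtilde Om (an n) (un n) @[n --> \oo] --> Jtilded Om u,
      Gamma_cvg Om (Jtilde Om) (Jtilded Om) &
      Gamma_cvg Om (fun a u => - Jtilde Om a u) (fun u => - Jtilded Om u)].
Proof.
move=> d0 /open_measurable_rV mO bO _.
have cv an u un := @Jtilde_cvg R d Om d0 mO bO an u un.
split=> [an aan u un u2 un2 uw||]; first exact: cv.
- by apply: continuous_cvg_Gamma => an u un; exact: cv.
- by apply: continuous_cvg_Gamma => an u un aan u2 un2 uw; apply: cvgN; exact: cv.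
Qed.
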